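(* Let $K$ be a field of characteristic different from $2$, and let $\varphi$ and $\psi$ be anisotropic quadratic forms over $K$ of dimension $\geq 2$. The following are equivalent: (1) $\varphi\sim_{stb}\psi$ (i.e. $\varphi_{K(\psi)}$ and $\psi_{K(\varphi)}$ are both isotropic); (2) for every field extension $F/K$, $D_F(\psi)D_F(\psi)=D_F(\varphi)D_F(\varphi)$; (3) for every field extension $F/K$, $N_F(\psi)=N_F(\varphi)$. If moreover $\varphi$ and $\psi$ both represent $1$, these are also equivalent to (4) for every field extension $F/K$, $T_F(\psi)=T_F(\varphi)$.
   Context: Quadratic forms are finite-dimensional and nondegenerate; a form is isotropic if it represents $0$ nontrivially. For a form $\varphi$ over $K$ and an extension $F/K$: $D_F(\varphi)$ is the set of nonzero elements of $F$ represented by $\varphi_F$; $D_F(\varphi)D_F(\varphi)=\{ab:a,b\in D_F(\varphi)\}$; $T_F(\varphi)$ is the subgroup of $F^\ast$ generated by $D_F(\varphi)$; $N_F(\varphi)$ is the subgroup of $F^\ast$ generated by $D_F(\varphi)D_F(\varphi)$. For $\psi\simeq\langle b_1,\ldots,b_n\rangle$, $n\ge2$, the function field is $K(\psi)=K(X_2,\ldots,X_n)\bigl(\sqrt{-\tfrac{1}{b_1}(b_2X_2^2+\cdots+b_nX_n^2)}\bigr)$. Two forms are stably birationally equivalent, $\varphi\sim_{stb}\psi$, if $\varphi_{K(\psi)}$ and $\psi_{K(\varphi)}$ are both isotropic. *)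

(* Defs.v *)
From HB Require Import structures.
From Stdlib Require Import ClassicalEpsilon.
From mathcomp Require Import all_boot all_algebra all_field.
From mathcomp.multinomials Require Import mpoly.

Set Implicit Arguments.
Unset Strict Implicit.
Unset Printing Implicit Defensive.

Import GRing.Theory.
Local Open Scope ring_scope.

Record field_ext (K : fieldType) := FieldExt {
  ext_field :> fieldType;
  ext_incl : {rmorphism K -> ext_field}
}.

(* Over a field of characteristic different from 2, a nondegenerate quadratic *)
(* form of dimension n is given by its symmetric invertible Gram matrix.      *)
Record qform (K : fieldType) (n : nat) := QForm {
  gram : 'M[K]_n;
  gram_sym : gram^T = gram;
  gram_unit : gram \in unitmx
}.

Definition qeval (K : fieldType) (n : nat) (phi : qform K n) (v : 'rV[K]_n) : K :=
  (v *m gram phi *m v^T) 0 0.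

Definition isotropic (K : fieldType) (n : nat) (phi : qform K n) : Prop :=
  exists v : 'rV[K]_n, v != 0 /\ qeval phi v = 0.

Definition anisotropic (K : fieldType) (n : nat) (phi : qform K n) : Prop :=
  ~ isotropic phi.

Definition represents (K : fieldType) (n : nat) (phi : qform K n) (x : K) : Prop :=
  exists v : 'rV[K]_n, qeval phi v = x.

Section BaseChange.
Variables (K : fieldType) (F : field_ext K) (n : nat) (phi : qform K n).

Fact base_change_sym :
  (map_mx (ext_incl F) (gram phi))^T = map_mx (ext_incl F) (gram phi).
Proof. by rewrite matrix.map_trmx gram_sym. Qed.

Fact base_change_unit : map_mx (ext_incl F) (gram phi) \in unitmx.
Proof. by rewrite map_unitmx gram_unit. Qed.

Definition base_change : qform F n := QForm base_change_sym base_change_unit.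
End BaseChange.

Definition Dset (K : fieldType) (F : field_ext K) (n : nat) (phi : qform K n)
  (x : F) : Prop := x != 0 /\ represents (base_change F phi) x.

Definition DDset (K : fieldType) (F : field_ext K) (n : nat) (phi : qform K n)
  (x : F) : Prop := exists a b : F, [/\ Dset phi a, Dset phi b & x = a * b].

Record mul_subgroup (F : fieldType) (G : F -> Prop) : Prop := MulSubgroup {
  mul_subgroup_neq0 : forall x, G x -> x != 0;
  mul_subgroup1 : G 1;
  mul_subgroupM : forall x y, G x -> G y -> G (x * y);
  mul_subgroupV : forall x, G x -> G x^-1
}.

Definition gen_mul_subgroup (F : fieldType) (S : F -> Prop) (x : F) : Prop :=
  forall G : F -> Prop, mul_subgroup G -> (forall y, S y -> G y) -> G x.

Definition Tgroup (K : fieldType) (F : field_ext K) (n : nat) (phi : qform K n)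
  : F -> Prop := gen_mul_subgroup (Dset (F := F) phi).

Definition Ngroup (K : fieldType) (F : field_ext K) (n : nat) (phi : qform K n)
  : F -> Prop := gen_mul_subgroup (DDset (F := F) phi).

(* phi ~ <b_1, ..., b_n> *)
Definition diagonalizes (K : fieldType) (n : nat) (phi : qform K n)
    (b : 'rV[K]_n) : Prop :=
  exists P : 'M[K]_n, P \in unitmx /\ P *m gram phi *m P^T = diag_mx b.

Lemma diagonal_exists (K : fieldType) (n : nat) (phi : qform K n) :
  2%N \notin [pchar K] -> exists b, diagonalizes phi b.
Proof.
move=> ch2; have two0 : (2%:R : K) != 0 by move: ch2; rewrite inE.
have : (gram phi)^T = gram phi by apply: gram_sym.
rewrite /diagonalizes; move: (gram phi) => {phi}.
elim: n => [|n IHn] A symA.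
  by exists 0, 1%:M; split; [exact: unitmx1 | apply/matrixP=> -[]].
have [->|A0] := eqVneq A 0.
  exists 0, 1%:M; split; first exact: unitmx1.
  by rewrite mulmx0 mul0mx; apply/matrixP=> i j; rewrite !mxE mul0rn.
have [v qv] : exists v : 'rV_n.+1, (v *m A *m v^T) 0 0 != 0.
  have symE i j : A i j = A j i by rewrite -[in LHS]symA mxE.
  pose e i : 'rV[K]_n.+1 := delta_mx 0 i.
  have dE i j : (e i *m A *m (e j)^T) 0 0 = A i j.
    by rewrite /e -rowE trmx_delta -colE !mxE.
  have [i [j Aij]] : exists i j, A i j != 0.
    case: (pickP (fun ij : 'I_n.+1 * 'I_n.+1 => A ij.1 ij.2 != 0)) => [[i j]|A00].
      by exists i, j.
    case/eqP: A0; apply/matrixP=> i j; rewrite mxE; apply/eqP.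
    by move/negbFE: (A00 (i, j)).
  have [Aii|Aii] := eqVneq (A i i) 0; last by exists (e i); rewrite dE.
  have [Ajj|Ajj] := eqVneq (A j j) 0; last by exists (e j); rewrite dE.
  exists (e i + e j).
  have addE (M N : 'M[K]_1) : (M + N) 0 0 = M 0 0 + N 0 0 by rewrite mxE.
  rewrite linearD /= mulmxDr !mulmxDl !addE !dE.
  rewrite Aii Ajj (symE j i) addr0 add0r -mulr2n -mulr_natr.
  by rewrite mulf_neq0.
pose P0 := row_ebase v.
have [c vE] : exists c, v = c *: row 0 P0.
  exists (col_ebase v 0 0).
  have r1 : \rank v = 1%N.
    apply/eqP; rewrite eqn_leq rank_leq_row lt0n mxrank_eq0.
    by apply: contra qv => /eqP->; rewrite !mul0mx mxE.
  rewrite -[v in LHS]mulmx_ebase r1 [col_ebase v]mx11_scalar.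
  rewrite -mulmxA mul_scalar_mx; congr (_ *: _).
    by rewrite mxE eqxx mulr1n.
  rewrite rowE; congr (_ *m _); apply/matrixP=> i j.
  by rewrite !ord1 !mxE eqxx andbT /= eq_sym.
pose A1 : 'M_(1 + n) := P0 *m A *m P0^T.
have symA1 : A1^T = A1 by rewrite /A1 !trmx_mul trmxK symA mulmxA.
pose a := A1 0 0.
have a0 : a != 0.
  apply: contra qv => /eqP a0; rewrite vE linearZ /= -scalemxAr -!scalemxAl.
  rewrite 2!mxE; suff -> : (row 0 P0 *m A *m (row 0 P0)^T) 0 0 = a.
    by rewrite a0 !mulr0.
  rewrite /a /A1 -row_mul [LHS]mxE [RHS]mxE.
  by apply: eq_bigr => k _; rewrite mxE [X in _ * X = _]mxE [X in _ * X = _]mxE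
    [X in _ = _ * X]mxE.
pose u := ursubmx A1; pose B := drsubmx A1.
have A1E : A1 = block_mx a%:M u u^T B.
  rewrite -[LHS]submxK; congr block_mx; last by rewrite /u trmx_ursub symA1.
  rewrite [LHS]mx11_scalar; congr _%:M; rewrite /a [LHS]mxE [LHS]mxE.
  by congr (fun_of_matrix A1 _ _); apply/val_inj.
have symB : B^T = B by rewrite /B trmx_drsub symA1.
pose B1 := B - a^-1 *: (u^T *m u).
have [b [P1 [P1u P1E]]] : exists b, exists P : 'M_n, P \in unitmx /\
    P *m B1 *m P^T = diag_mx b.
  by apply: IHn; rewrite /B1 linearB /= linearZ /= trmx_mul trmxK symB.
pose Q : 'M_(1 + n) := block_mx 1%:M 0 (- a^-1 *: u^T) 1%:M.
pose R : 'M_(1 + n) := block_mx 1%:M 0 0 P1.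
have Ru : R \in unitmx by rewrite unitmxE det_lblock det1 mul1r -unitmxE.
have Qu : Q \in unitmx by rewrite unitmxE det_lblock !det1 mul1r unitr1.
exists (row_mx a%:M b), (R *m Q *m P0); split.
  by rewrite !unitmx_mul Ru Qu row_ebase_unit.
transitivity (R *m (Q *m A1 *m Q^T) *m R^T).
  by rewrite /A1 !trmx_mul !mulmxA.
have -> : Q *m A1 *m Q^T = block_mx a%:M 0 0 B1.
  rewrite A1E /Q tr_block_mx !trmx1 trmx0 !mulmx_block.
  rewrite !mul1mx !mul0mx !mulmx0 !mulmx1 !addr0 linearZ /= trmxK.
  rewrite -!scalemxAl mul_mx_scalar scalerA mulNr mulVf // scaleN1r addNr.
  rewrite mul0mx add0r mul_scalar_mx scalerA mulrN mulfV // scaleN1r addNr.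
  by rewrite scaleNr addrC.
rewrite /R tr_block_mx !trmx1 !trmx0 !mulmx_block.
rewrite !mul1mx !mul0mx !mulmx0 !mulmx1 !addr0 !add0r P1E mul0mx.
transitivity (diag_mx (row_mx a%:M b : 'rV_(1 + n))) => //.
have aE : diag_mx a%:M = a%:M :> 'M[K]_1.
  by apply/matrixP=> i j; rewrite !ord1 !mxE.
by rewrite diag_mx_row aE.
Qed.

(* Some diagonalization of phi; the choice is immaterial, since isometric     *)
(* diagonal forms have K-isomorphic function fields.                          *)
Definition diagonalization (K : fieldType) (n : nat) (phi : qform K n) : 'rV[K]_n :=
  epsilon (inhabits 0) (diagonalizes phi).

Lemma diagonalizationP (K : fieldType) (n : nat) (phi : qform K n) :
  2%N \notin [pchar K] -> diagonalizes phi (diagonalization phi).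
Proof. by move=> ch2; apply: epsilon_spec; apply: diagonal_exists. Qed.

Section AdjoinSqrt.
Variables (L : fieldType) (d : L).

Fact sqrt_poly_monic_irreducible :
  ~ (exists s : L, s ^+ 2 = d) -> monic_irreducible_poly ('X^2 - d%:P).
Proof.
move=> nsq; split; last exact: monicXnsubC.
apply: cubic_irreducible => [|x]; first by rewrite size_XnsubC.
apply/negP; rewrite /root !hornerE subr_eq0 => /eqP xd.
by apply: nsq; exists x.
Qed.

Section Nonsquare.
Variable nsq : ~ (exists s : L, s ^+ 2 = d).
Let hI := sqrt_poly_monic_irreducible nsq.

Fact qfpoly_const_zmod : zmod_morphism (qfpoly_const hI).
Proof. exact: qpolyC_is_zmod_morphism. Qed.

Fact qfpoly_const_monoid : monoid_morphism (qfpoly_const hI).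
Proof. exact: qpolyC_is_monoid_morphism. Qed.

HB.instance Definition _ := GRing.isZmodMorphism.Build L
  {poly %/ 'X^2 - d%:P with hI} (qfpoly_const hI) qfpoly_const_zmod.
HB.instance Definition _ := GRing.isMonoidMorphism.Build L
  {poly %/ 'X^2 - d%:P with hI} (qfpoly_const hI) qfpoly_const_monoid.

Definition quadratic_ext : field_ext L :=
  @FieldExt L {poly %/ 'X^2 - d%:P with hI} (qfpoly_const hI).
End Nonsquare.

(* L(sqrt d): L itself if d is already a square, L[T]/(T^2 - d) otherwise.    *)
Definition adjoin_sqrt : field_ext L :=
  match excluded_middle_informative (exists s : L, s ^+ 2 = d) with
  | left _ => @FieldExt L L idfun
  | right nsq => quadratic_ext nsq
  end.
End AdjoinSqrt.

Section FunctionField.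
Variables (K : fieldType) (n : nat) (psi : qform K n.+2).

Definition ratfun_field : fieldType := {fraction {mpoly K[n.+1]}}.

Definition ratfun_const : {rmorphism K -> ratfun_field} :=
  @FracField.tofrac {mpoly K[n.+1]} \o @mpolyC n.+1 K.

(* - (b_2 X_2^2 + ... + b_n X_n^2) / b_1; the indices 2, ..., n of the        *)
(* variables become i = 0, ..., and b_(i+2) is b 0 (lift ord0 i).             *)
Definition function_field_radicand : ratfun_field :=
  let b := diagonalization psi in
  - (ratfun_const (b 0 ord0))^-1 *
  \sum_(i < n.+1)
    ratfun_const (b 0 (lift ord0 i)) *
    (FracField.tofrac ('X_i : {mpoly K[n.+1]})) ^+ 2.

Definition function_field : field_ext K :=
  let E := adjoin_sqrt function_field_radicand in
  @FieldExt K E (ext_incl E \o ratfun_const).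
End FunctionField.

Definition stably_birational (K : fieldType) (m n : nat)
    (phi : qform K m.+2) (psi : qform K n.+2) : Prop :=
  isotropic (base_change (function_field psi) phi) /\
  isotropic (base_change (function_field phi) psi).

(* Main.v *)
(**
Let L = K(phi).  If psi has a zero over L and phi has a zero w over F, then so
does psi: a zero of psi over L is f + g sqrt(d) with f, g vectors of polynomials,
hence a zero of psi at every point of the quadric phi = 0.  Evaluating it at the
rational parametrization S (phi(Y) w - 2 B(w,Y) Y) of that quadric over F gives
a nonzero zero of psi over F[Y, S], whose leading coefficients are a zero over F.

(1) => (2): if x = phi(u) phi(v), c = B(u,v) and delta = c^2 - x, then phi has a
zero over F(sqrt delta), hence so does psi.  Unless psi is already isotropic
over F, this gives f, g with B(f,g) = 0 and psi(f) = - delta psi(g), so that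
psi(c g + f) = psi(g) x.

(3) => (1): psi is isotropic over K(psi)(t), so t lies in N(psi) = N(phi), while
a form anisotropic over K(psi) only represents elements of even degree in t.
*)
Require Import Defs.
From HB Require Import structures.
From Stdlib Require Import ClassicalEpsilon.
From mathcomp Require Import all_boot all_order all_algebra all_field.
From mathcomp.multinomials Require Import mpoly.
From mathcomp Require Import ring.

Set Implicit Arguments.
Unset Strict Implicit.
Unset Printing Implicit Defensive.

Import Order.TTheory GRing.Theory.
Local Open Scope ring_scope.

(** * Symmetric bilinear forms over commutative rings *)

Definition bilin (R : comNzRingType) (n : nat) (A : 'M[R]_n) (u v : 'rV[R]_n) : R :=
  (u *m A *m v^T) 0 0.

Section Bilin.
Variables (R : comNzRingType) (n : nat) (A : 'M[R]_n).
Implicit Types u v w : 'rV[R]_n.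

Lemma bilinDl u v w : bilin A (u + v) w = bilin A u w + bilin A v w.
Proof. by rewrite /bilin !mulmxDl mxE. Qed.

Lemma bilinDr u v w : bilin A u (v + w) = bilin A u v + bilin A u w.
Proof. by rewrite /bilin linearD /= mulmxDr mxE. Qed.

Lemma bilinZl c u v : bilin A (c *: u) v = c * bilin A u v.
Proof. by rewrite /bilin -!scalemxAl mxE. Qed.

Lemma bilinZr c u v : bilin A u (c *: v) = c * bilin A u v.
Proof. by rewrite /bilin linearZ /= -scalemxAr mxE. Qed.

Lemma bilinE u v : bilin A u v = \sum_i \sum_j u 0 i * A i j * v 0 j.
Proof.
rewrite exchange_big /bilin mxE; apply: eq_bigr => j _.
by rewrite !mxE mulr_suml.
Qed.

Lemma bilin_mul (P : 'M[R]_n) u v :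
  bilin A (u *m P) (v *m P) = bilin (P *m A *m P^T) u v.
Proof. by rewrite /bilin trmx_mul !mulmxA. Qed.

Hypothesis symA : A^T = A.

Lemma bilinC u v : bilin A u v = bilin A v u.
Proof.
rewrite !bilinE exchange_big; do 2!apply: eq_bigr => ? _.
by rewrite -[in LHS]symA mxE; ring.
Qed.

Lemma bilin_comb c d u v :
  bilin A (c *: u + d *: v) (c *: u + d *: v) =
  c ^+ 2 * bilin A u u + c * d * bilin A u v *+ 2 + d ^+ 2 * bilin A v v.
Proof.
rewrite bilinDl !bilinDr !bilinZl !bilinZr [bilin A v u]bilinC; ring.
Qed.

(* The second intersection point with the quadric of the line through the    *)
(* isotropic point w and the point y.                                         *)
Definition quadric_point s w y : 'rV[R]_n :=
  s *: (bilin A y y *: w + - (bilin A w y *+ 2) *: y).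

Lemma quadric_point_isotropic s w y : bilin A w w = 0 ->
  bilin A (quadric_point s w y) (quadric_point s w y) = 0.
Proof. by move=> w0; rewrite bilinZl bilinZr bilin_comb w0; ring. Qed.

End Bilin.

Lemma bilin_diag (R : comNzRingType) (n : nat) (b : 'rV[R]_n) (u v : 'rV[R]_n) :
  bilin (diag_mx b) u v = \sum_i b 0 i * u 0 i * v 0 i.
Proof.
rewrite bilinE; apply: eq_bigr => i _; rewrite (bigD1 i) //= big1 ?addr0.
  by rewrite mxE eqxx mulr1n [b 0 i * _]mulrC.
by move=> j; rewrite mxE eq_sym => /negPf->; rewrite mulr0 mul0r.
Qed.

Section BilinMap.
Variables (R S : comNzRingType) (f : {rmorphism R -> S}) (n : nat).

Lemma bilin_map (A : 'M[R]_n) u v :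
  bilin (map_mx f A) (map_mx f u) (map_mx f v) = f (bilin A u v).
Proof. by rewrite /bilin matrix.map_trmx -!map_mxM mxE. Qed.

Lemma map_quadric_point (A : 'M[R]_n) s w y :
  map_mx f (quadric_point A s w y) =
  quadric_point (map_mx f A) (f s) (map_mx f w) (map_mx f y).
Proof.
by rewrite /quadric_point !bilin_map !(map_mxZ, map_mxD) rmorphN rmorphMn.
Qed.
End BilinMap.

(** * Isotropy, universality and leading monomials *)

Lemma anisotropicP (K : fieldType) (n : nat) (phi : qform K n) :
  anisotropic phi <-> forall v, bilin (gram phi) v v = 0 -> v = 0.
Proof.
split=> [aphi v qv|aphi [v [v0 qv]]]; last by rewrite (aphi v qv) eqxx in v0.
by apply/eqP/negPn/negP => v0; apply: aphi; exists v.
Qed.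

(** By nondegeneracy some [y] is not orthogonal to the isotropic vector [v]. The value at c v + y is
    then affine in [c] with slope 2 B(v,y), hence takes every value. *)
Lemma isotropic_universal (K : fieldType) (n : nat) (phi : qform K n) (x : K) :
  2%:R != 0 :> K -> isotropic phi -> represents phi x.
Proof.
move=> two0 [v [v0 qv]].
have [y Bvy] : exists y, bilin (gram phi) v y != 0.
  have /rV0Pn[i vi] : v *m gram phi != 0.
    by apply: contra v0 => /eqP e; rewrite -[v](mulmxK (gram_unit phi)) e mul0mx.
  exists (delta_mx 0 i); rewrite /bilin trmx_delta -colE mxE; exact: vi.
pose c := (x - bilin (gram phi) y y) / (bilin (gram phi) v y *+ 2).
exists (c *: v + 1 *: y).
rewrite /qeval -/(bilin _ _ _) (bilin_comb (gram_sym phi)).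
rewrite -/(qeval _ _) in qv *; rewrite [bilin _ v v]qv /c; field.
by rewrite two0.
Qed.

(* The leading coefficients of the components of H at the largest leading     *)
(* monomial m form a nonzero vector c, and A(c, c) is the coefficient of      *)
(* m + m in A(H, H).                                                          *)
Lemma mlead_anisotropic (F : fieldType) (k n : nat) (A : 'M[F]_n)
    (H : 'rV[{mpoly F[k]}]_n) :
  (forall v, bilin A v v = 0 -> v = 0) -> H != 0 ->
  bilin (map_mx (@mpolyC k F) A) H H != 0 /\
  exists m, mlead (bilin (map_mx (@mpolyC k F) A) H H) = (m + m)%MM.
Proof.
move=> aA H0; set q := bilin _ H H.
have /rV0Pn[i0 Hi0] := H0.
pose m := mlead (H 0 [arg max_(i > i0 | H 0 i != 0) mlead (H 0 i)]%O).
have [i1 Hi1 mE] : exists2 i, H 0 i != 0 & m = mlead (H 0 i).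
  rewrite /m; case: arg_maxP => // i Hi _; by exists i.
have mmax i : (mlead (H 0 i) <= m)%O.
  have [->|Hi] := eqVneq (H 0 i) 0; first by rewrite mlead0 le0x.
  by rewrite /m; case: arg_maxP => // j _ /(_ i Hi).
pose c : 'rV[F]_n := \row_i (H 0 i)@_m.
have qm : q@_(m + m)%MM = bilin A c c.
  rewrite /q !bilinE raddf_sum; apply: eq_bigr => i _.
  rewrite raddf_sum; apply: eq_bigr => j _ /=.
  by rewrite !mxE mulrAC mulrC mcoeffCM mleadcMW // mulrA [A i j * _]mulrC.
have qmN0 : q@_(m + m)%MM != 0.
  rewrite qm; apply: contraNneq Hi1 => /aA/matrixP/(_ 0 i1).
  by rewrite !mxE mE => /eqP; rewrite mleadc_eq0.
have q0 : q != 0 by apply: contraNneq qmN0 => ->; rewrite mcoeff0.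
split=> //; exists m; apply: le_anti; apply/andP; split; last first.
  by rewrite msupp_le_mlead // mcoeff_msupp.
rewrite /q bilinE; apply: (le_trans (mlead_sum_le _ _ _)).
apply/joinsP_seq => i _ _; apply: (le_trans (mlead_sum_le _ _ _)).
apply/joinsP_seq => j _ _; rewrite !mxE mulrAC mulrC.
apply: (le_trans (mleadM_le _ _)); rewrite mleadC add0m.
by apply: (le_trans (mleadM_le _ _)); apply: lem_add.
Qed.

(** * Denominators and quadratic extensions *)

Lemma fracP (R : idomainType) (x : {fraction R}) :
  exists p q : R, q != 0 /\ x * FracField.tofrac q = FracField.tofrac p.
Proof.
elim/quotW: x => r; exists \n_r, \d_r; split; first exact: denom_ratioP.
rewrite /FracField.tofrac; unlock.
rewrite -[LHS]FracField.pi_mul; apply/eqmodP; rewrite /= FracField.equivfE.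
rewrite /FracField.mulf !numden_Ratio ?oner_neq0 ?mulr1 ?mul1r ?denom_ratioP //.
by rewrite mulrC.
Qed.

Lemma common_denominator (R : idomainType) (n : nat) (v : 'rV[{fraction R}]_n) :
  exists q (H : 'rV[R]_n), q != 0 /\
    FracField.tofrac q *: v = map_mx (@FracField.tofrac R) H.
Proof.
have [p pP] : exists p : 'I_n -> R * R, forall i, (p i).2 != 0 /\
    v 0 i * FracField.tofrac (p i).2 = FracField.tofrac (p i).1.
  apply: (fin_all_exists (P := fun i (a : R * R) => a.2 != 0 /\
    v 0 i * FracField.tofrac a.2 = FracField.tofrac a.1)) => i.
  by have [a [b []]] := fracP (v 0 i); exists (a, b).
exists (\prod_i (p i).2), (\row_i ((p i).1 * \prod_(j | j != i) (p j).2)).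
split; first by apply/prodf_neq0 => i _; case: (pP i).
apply/rowP => i; rewrite !mxE (bigD1 i) //= !rmorphM /= -(pP i).2; ring.
Qed.

(** No uniqueness is claimed, so that both cases fit: if [d] is a square, the extension is [L]
    itself and [b = 0] works; otherwise [s] is the class of X, and [a], [b] are the coefficients of
    the reduced representative. *)
Lemma adjoin_sqrtP (L : fieldType) (d : L) :
  exists2 s : adjoin_sqrt d, s ^+ 2 = ext_incl (adjoin_sqrt d) d &
    forall x, exists a b,
      x = ext_incl (adjoin_sqrt d) a + s * ext_incl (adjoin_sqrt d) b.
Proof.
rewrite /adjoin_sqrt; case: excluded_middle_informative => [[s sd]|nsq].
  by exists s => // x; exists x, 0; rewrite /= mulr0 addr0.
have hI := sqrt_poly_monic_irreducible nsq.
have hE : mk_monic ('X^2 - d%:P) = 'X^2 - d%:P by apply: mk_monicE hI.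
have sz : size (mk_monic ('X^2 - d%:P)) = 3 by rewrite hE size_XnsubC.
pose h : {poly L} := 'X^2 - d%:P.
have cE (a : L) : qpolyC h a = in_qpoly h a%:P.
  apply: val_inj; rewrite [RHS]in_qpoly_small // sz size_polyC; by case: eqP.
have sq : in_qpoly h 'X ^+ 2 = qpolyC h d :> {poly %/ h}.
  rewrite cE -rmorphXn; apply/eqP; rewrite -subr_eq0 -raddfB; apply/eqP.
  by apply: val_inj; rewrite /= hE Pdiv.RingMonic.rmodpp // hI.2.
have dec (x : {poly %/ h}) :
    x = qpolyC h (val x)`_0 + in_qpoly h 'X * qpolyC h (val x)`_1.
  rewrite !cE -rmorphM -raddfD.
  apply: val_inj; rewrite [RHS]in_qpoly_small.
    apply/polyP => i; rewrite coefD coefC coefXM coefC.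
    have szx : (size (val x) < 3)%N by rewrite -[3%N]sz; apply: size_mk_monic.
    case: i => [|[|i]] /=; rewrite ?addr0 ?add0r //.
    by rewrite nth_default // -ltnS (leq_trans szx).
  move: (val x)`_0 (val x)`_1 => a b; rewrite sz ltnS.
  rewrite (leq_trans (size_polyD _ _)) // geq_max.
  rewrite (leq_trans (size_polyC_leq1 _)) // (leq_trans (size_polyMleq _ _)) //.
  by rewrite size_polyX; have := size_polyC_leq1 b; case: size => [|[]].
by exists (in_qpoly h 'X) => // x; exists (val x)`_0, (val x)`_1; apply: dec.
Qed.

Section AdjoinSqrtForm.
Variables (L : fieldType) (d : L) (n : nat) (A : 'M[L]_n).
Local Notation E := (adjoin_sqrt d).
Local Notation iota := (ext_incl E).

Lemma isotropic_adjoin_square : (exists s, s ^+ 2 = d) ->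
  (exists v : 'rV[E]_n, v != 0 /\ bilin (map_mx iota A) v v = 0) ->
  exists f : 'rV[L]_n, f != 0 /\ bilin A f f = 0.
Proof.
rewrite /adjoin_sqrt; case: excluded_middle_informative => [sq _|nsq /nsq//].
by case=> v /=; rewrite map_mx_id => // hv; exists v.
Qed.

Hypotheses (symA : A^T = A) (two0 : 2%:R != 0 :> L).

(** Write v = f + s g. The two equations are the components of A(v,v) = 0 along 1 and [s]. *)
Lemma isotropic_adjoin_nonsquare (v : 'rV[E]_n) :
  ~ (exists s, s ^+ 2 = d) -> v != 0 -> bilin (map_mx iota A) v v = 0 ->
  exists f g : 'rV[L]_n, [/\ (f != 0) || (g != 0),
    bilin A f f + d * bilin A g g = 0 & bilin A f g = 0].
Proof.
move=> nsq v0 qv; have [s sd sP] := adjoin_sqrtP d.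
have indep a b : iota a + s * iota b = 0 -> a = 0 /\ b = 0.
  have [-> /eqP|b0 e] := eqVneq b 0.
    by rewrite rmorph0 mulr0 addr0 fmorph_eq0 => /eqP.
  (* A relation with [b] nonzero would put [s] into [L]. *)
  case: nsq; exists (- a / b); apply: (fmorph_inj iota).
  rewrite rmorphXn fmorph_div rmorphN -sd; congr (_ ^+ 2).
  by rewrite -[iota a](addrK (s * iota b)) e add0r opprK mulfK // fmorph_eq0.
have [p pP] : exists p : 'I_n -> L * L,
    forall i, v 0 i = iota (p i).1 + s * iota (p i).2.
  apply: (fin_all_exists (P := fun i (a : L * L) =>
    v 0 i = iota a.1 + s * iota a.2)) => i.
  by have [a [b e]] := sP (v 0 i); exists (a, b).
pose f := \row_i (p i).1; pose g := \row_i (p i).2; exists f, g.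
have vE : v = 1 *: map_mx iota f + s *: map_mx iota g.
  by apply/rowP => i; rewrite pP !mxE mul1r.
have symiA : (map_mx iota A)^T = map_mx iota A by rewrite matrix.map_trmx symA.
move: qv; rewrite vE (bilin_comb symiA) !bilin_map sd => qv.
have [|q0 Bfg] := indep (bilin A f f + d * bilin A g g) (bilin A f g *+ 2).
  rewrite -[RHS]qv rmorphD rmorphM rmorphMn; ring.
split=> //; last first.
  by apply/eqP; move/eqP: Bfg; rewrite -mulr_natr mulf_eq0 (negPf two0) orbF.
apply: contraNT v0; rewrite negb_or !negbK vE => /andP[/eqP-> /eqP->].
by rewrite !map_mx0 !scaler0 addr0.
Qed.

End AdjoinSqrtForm.

(** * Evaluation at points of a quadric *)

Lemma mmap_rmorph (k : nat) (R S T : comNzRingType) (h : {rmorphism S -> T})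
    (i : {rmorphism R -> S}) (x : 'I_k -> S) (p : {mpoly R[k]}) :
  h (mmap i x p) = mmap (h \o i) (h \o x) p.
Proof.
rewrite /mmap rmorph_sum; apply: eq_bigr => m _; rewrite rmorphM rmorph_prod.
by congr (_ * _); apply: eq_bigr => j _; rewrite rmorphXn.
Qed.

Section FunctionFieldZero.
Variables (K : fieldType) (n m : nat) (b : 'rV[K]_n.+2) (A : 'M[K]_m).

(** The diagonal form without its first term: the quadric is b_1 X_1^2 + [quad_poly] = 0, and the
    radicand of its function field is - [quad_poly] / b_1. *)
Definition quad_poly : {mpoly K[n.+1]} :=
  \sum_i (b 0 (lift ord0 i))%:MP * 'X_i ^+ 2.

Definition eval_at (R : comNzRingType) (i : {rmorphism K -> R})
    (z : 'rV[R]_n.+2) : {mpoly K[n.+1]} -> R :=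
  mmap i (fun k => z 0 (lift ord0 k)).

HB.instance Definition _ (R : comNzRingType) (i : {rmorphism K -> R})
  (z : 'rV[R]_n.+2) := GRing.RMorphism.on (eval_at i z).

Lemma eval_at_rmorph (R : comNzRingType) (i : {rmorphism K -> R})
    (z : 'rV[R]_n.+2) (h : {rmorphism {mpoly K[n.+1]} -> R}) :
  (forall c, h c%:MP = i c) -> (forall k, h 'X_k = z 0 (lift ord0 k)) ->
  eval_at i z =1 h.
Proof.
move=> hC hX p; rewrite {2}[p]mpolyE rmorph_sum; apply: eq_bigr => k _.
rewrite -mul_mpolyC rmorphM hC mpolyXE_id rmorph_prod; congr (_ * _).
by apply: eq_bigr => l _; rewrite rmorphXn hX.
Qed.

(** The value at [z] of f + g sqrt(d): the first coordinate of [z] replaces sqrt(d), the others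
    replace the variables. The scalar [1] gives the shape expected by [bilin_comb]. *)
Definition eval_row (R : comNzRingType) (i : {rmorphism K -> R})
    (f g : 'rV[{mpoly K[n.+1]}]_m) (z : 'rV[R]_n.+2) : 'rV[R]_m :=
  1 *: map_mx (eval_at i z) f + z 0 0 *: map_mx (eval_at i z) g.

Lemma map_eval_row (R S : comNzRingType) (h : {rmorphism R -> S})
    (i : {rmorphism K -> R}) f g z :
  map_mx h (eval_row i f g z) = eval_row (h \o i) f g (map_mx h z).
Proof.
apply/rowP => j; rewrite !mxE rmorphD !rmorphM rmorph1 /eval_at !mmap_rmorph.
have e p : mmap (h \o i) (h \o (fun k => z 0 (lift ord0 k))) p =
    mmap (h \o i) (fun k => map_mx h z 0 (lift ord0 k)) p.
  apply: eq_bigr => mm _; congr (_ * _); apply: mmap1_eq => k /=.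
  by rewrite mxE.
by rewrite !e.
Qed.

Lemma eval_quad_poly (R : comNzRingType) (i : {rmorphism K -> R}) z :
  bilin (map_mx i (diag_mx b)) z z =
  i (b 0 0) * z 0 0 ^+ 2 + eval_at i z quad_poly.
Proof.
rewrite map_diag_mx bilin_diag big_ord_recl mxE; congr (_ + _); first by ring.
rewrite rmorph_sum; apply: eq_bigr => j _ /=.
by rewrite rmorphM rmorphXn /= /eval_at mmapC mmapX mmap1U mxE; ring.
Qed.

(** With q the value of [quad_poly] at [z], b_1 A(f + z_0 g) = (q + b_1 z_0^2) A(g,g), and the first
    factor is the value of the diagonal form at [z]. *)
Lemma eval_row_isotropic (R : comNzRingType) (i : {rmorphism K -> R}) f g z :
  A^T = A -> b 0 0 != 0 ->
  bilin (map_mx i (diag_mx b)) z z = 0 ->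
  (b 0 0)%:MP * bilin (map_mx (@mpolyC _ K) A) f f =
    quad_poly * bilin (map_mx (@mpolyC _ K) A) g g ->
  bilin (map_mx (@mpolyC _ K) A) f g = 0 ->
  bilin (map_mx i A) (eval_row i f g z) (eval_row i f g z) = 0.
Proof.
move=> symA b0; rewrite eval_quad_poly => zz ffgg fg.
have symiA : (map_mx i A)^T = map_mx i A by rewrite matrix.map_trmx symA.
have iE : map_mx i A = map_mx (eval_at i z) (map_mx (@mpolyC _ K) A).
  by apply/matrixP => k l; rewrite !mxE /eval_at mmapC.
rewrite (bilin_comb symiA) iE !bilin_map fg rmorph0 /=.
move: (bilin _ f f) (bilin _ g g) ffgg => X Y XY.
(* [R] is only a ring, so b_1 is inverted in [K] before being mapped. *)
have ib : i (b 0 0)^-1 * i (b 0 0) = 1 by rewrite -rmorphM mulVf // rmorph1.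
have {XY} : i (b 0 0) * eval_at i z X = eval_at i z quad_poly * eval_at i z Y.
  by rewrite -[RHS]rmorphM -XY [RHS]rmorphM /= [X in _ = X * _]mmapC.
move: (eval_at i z X) (eval_at i z Y) (eval_at i z quad_poly) zz => F G q zz e.
transitivity (i (b 0 0)^-1 * i (b 0 0) * (F + z 0 0 ^+ 2 * G)).
  by rewrite ib; ring.
by rewrite -mulrA mulrDr mulrA e -mulrDl addrC zz mul0r mulr0.
Qed.

End FunctionFieldZero.

(** * Zeros over the function field of a quadric *)

Lemma diagonalization_neq0 (K : fieldType) (n : nat) (phi : qform K n) i :
  2%N \notin [pchar K] -> diagonalization phi 0 i != 0.
Proof.
move=> ch2; have [P [Pu PE]] := diagonalizationP phi ch2.
have : diag_mx (diagonalization phi) \in unitmx.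
  by rewrite -PE !unitmx_mul Pu gram_unit unitmx_tr.
by rewrite unitmxE det_diag unitfE => /prodf_neq0/(_ i)->.
Qed.

Section BaseChangeDiag.
Variables (K : fieldType) (F : field_ext K) (n : nat) (phi : qform K n).
Hypothesis ch2 : 2%N \notin [pchar K].
Local Notation D := (map_mx (ext_incl F) (diag_mx (diagonalization phi))).

Lemma isotropic_diag : isotropic (base_change F phi) <->
  exists w : 'rV[F]_n, w != 0 /\ bilin D w w = 0.
Proof.
have [P [Pu PE]] := diagonalizationP phi ch2.
pose Q := map_mx (ext_incl F) P.
have Qu : Q \in unitmx by rewrite map_unitmx.
have DE w : bilin D w w = qeval (base_change F phi) (w *m Q).
  rewrite /qeval -/(bilin _ _ _) bilin_mul -PE !map_mxM /= /Q.
  by rewrite matrix.map_trmx.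
split=> [[v [v0 qv]]|[w [w0 qw]]].
  exists (v *m invmx Q); rewrite DE mulmxKV //; split=> //.
  by apply: contra v0 => /eqP e; rewrite -[v](mulmxKV Qu) e mul0mx.
exists (w *m Q); rewrite -DE; split=> //.
by apply: contra w0 => /eqP e; rewrite -[w](mulmxK Qu) e mul0mx.
Qed.
End BaseChangeDiag.

Lemma pchar2_neq0 (K : fieldType) (F : field_ext K) :
  2%N \notin [pchar K] -> 2%:R != 0 :> F.
Proof.
rewrite inE /= => two0.
by rewrite -(rmorph_nat (ext_incl F)) fmorph_eq0.
Qed.

Lemma neq0_map_mx (R S : nzRingType) (f : {rmorphism R -> S}) (m n : nat)
    (A : 'M[R]_(m, n)) : map_mx f A != 0 -> A != 0.
Proof. by apply: contra => /eqP->; rewrite map_mx0. Qed.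

Lemma sqrt_norm_neq0 (L : fieldType) (d a b : L) :
  ~ (exists s, s ^+ 2 = d) -> (a != 0) || (b != 0) -> a ^+ 2 - d * b ^+ 2 != 0.
Proof.
move=> nsq ab; apply/negP => /eqP e; have [b0|b0] := eqVneq b 0.
  move: e ab; rewrite b0 eqxx orbF expr0n mulr0 subr0 => /eqP.
  by rewrite sqrf_eq0 => ->.
case: nsq; exists (a / b); rewrite expr_div_n.
by move/eqP: e; rewrite subr_eq0 => /eqP->; rewrite mulfK // expf_neq0.
Qed.

Lemma row_pair_neq0 (R : nzRingType) (n : nat) (f g : 'rV[R]_n) :
  (f != 0) || (g != 0) -> exists j, (f 0 j != 0) || (g 0 j != 0).
Proof. by case/orP=> /rV0Pn[j e]; exists j; rewrite e ?orbT. Qed.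

Section FunctionFieldIsotropy.
Variables (K : fieldType) (n : nat) (phi : qform K n.+2).
Hypothesis ch2 : 2%N \notin [pchar K].
Local Notation b := (diagonalization phi).
Local Notation Frac := (@FracField.tofrac {mpoly K[n.+1]}).

Lemma function_field_radicandE :
  Frac (b 0 0)%:MP * function_field_radicand phi = - Frac (quad_poly b).
Proof.
have b0 : ratfun_const K n (b 0 0) != 0.
  by rewrite fmorph_eq0 diagonalization_neq0.
rewrite /function_field_radicand mulrA mulrN mulfV // mulN1r; congr (- _).
rewrite rmorph_sum; apply: eq_bigr => i _.
by rewrite rmorphM rmorphXn.
Qed.

(** The zero is the generic point (sqrt(d), X_2, ..., X_n), nonzero because of X_2. *)
Lemma function_field_isotropic : isotropic (base_change (function_field phi) phi).
Proof.
apply/(isotropic_diag _ _ ch2).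
have [s sd _] := adjoin_sqrtP (function_field_radicand phi).
pose E := adjoin_sqrt (function_field_radicand phi).
pose th : {rmorphism {mpoly K[n.+1]} -> E} := ext_incl E \o Frac.
pose z : 'rV[E]_n.+2 := row_mx s%:M (\row_i th 'X_i : 'rV_n.+1).
have z0 : z 0 0 = s by rewrite mxE; case: splitP => // j _; rewrite mxE ord1.
have zS i : z 0 (lift ord0 i) = th 'X_i.
  rewrite mxE; case: splitP => [[[]]//|j /= e].
  by rewrite mxE; congr (th 'X__); apply: ord_inj; case: e.
exists z; split.
  apply/rV0Pn; exists (lift ord0 0); rewrite zS fmorph_eq0 tofrac_eq0.
  by rewrite -msupp_eq0 msuppX.
rewrite eval_quad_poly z0 sd /=.
have -> : eval_at (ext_incl E \o ratfun_const K n) z (quad_poly b) = th (quad_poly b).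
  by apply: eval_at_rmorph => // k; rewrite zS.
by rewrite -rmorphM [X in ext_incl _ X]function_field_radicandE rmorphN addNr.
Qed.

Variables (m : nat) (psi : qform K m).
Local Notation A := (map_mx (@mpolyC n.+1 K) (gram psi)).

(** This is a zero f + g sqrt(d) with denominators cleared. Its nonvanishing is stated through b_1
    times the norm of one coordinate, a polynomial over [K] that involves no choice of square
    root. *)
Lemma function_field_zero : anisotropic psi ->
  isotropic (base_change (function_field phi) psi) ->
  exists f g : 'rV[{mpoly K[n.+1]}]_m,
  [/\ (b 0 0)%:MP * bilin A f f = quad_poly b * bilin A g g,
      bilin A f g = 0 &
      exists j, (b 0 0)%:MP * f 0 j ^+ 2 + quad_poly b * g 0 j ^+ 2 != 0].
Proof.
move=> /anisotropicP apsi [v [v0 qv]].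
pose B := map_mx Frac A.
have BE : map_mx (ratfun_const K n) (gram psi) = B by rewrite /B -map_mx_comp.
have symB : B^T = B by rewrite -BE matrix.map_trmx gram_sym.
have two0 : 2%:R != 0 :> ratfun_field K n.
  exact: (pchar2_neq0 (Defs.FieldExt (ratfun_const K n)) ch2).
have F0 q : (Frac q == 0) = (q == 0) by rewrite tofrac_eq0.
have qv' : bilin (map_mx (ext_incl (adjoin_sqrt (function_field_radicand phi))) B) v v = 0.
  by rewrite -BE -map_mx_comp.
(* If the radicand were a square, [psi] would be isotropic over a rational function field of [K],
   which leading monomials forbid. *)
have [sq|nsq] := classic (exists s, s ^+ 2 = function_field_radicand phi).
  have [|f [f0 qf]] := @isotropic_adjoin_square _ _ _ B sq; first by exists v.
  have [q [H [q0 HE]]] := common_denominator f.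
  have H0 : H != 0.
    apply: (@neq0_map_mx _ _ Frac); rewrite -HE scaler_eq0 F0 negb_or q0.
    exact: f0.
  have [/negP[]] := mlead_anisotropic apsi H0.
  by rewrite -F0 -bilin_map -HE bilinZl bilinZr qf !mulr0.
have [f [g [fg0 qfg Bfg]]] := isotropic_adjoin_nonsquare symB two0 nsq v0 qv'.
have [q [H [q0 HE]]] := common_denominator (row_mx f g).
pose f' := lsubmx H; pose g' := rsubmx H.
have fE : map_mx Frac f' = Frac q *: f by rewrite map_lsubmx -HE scale_row_mx row_mxKl.
have gE : map_mx Frac g' = Frac q *: g by rewrite map_rsubmx -HE scale_row_mx row_mxKr.
have Finj : injective Frac by move=> x y /eqP; rewrite tofrac_eq => /eqP.
have rE := function_field_radicandE.
exists f', g'; split.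
- have ffE : Frac (bilin A f' f') = Frac q ^+ 2 * bilin B f f.
    by rewrite -bilin_map fE bilinZl bilinZr mulrA.
  have ggE : Frac (bilin A g' g') = Frac q ^+ 2 * bilin B g g.
    by rewrite -bilin_map gE bilinZl bilinZr mulrA.
  move: (bilin A f' f') (bilin A g' g') ffE ggE => X Y XE YE.
  have {}qfg : bilin B f f = - (function_field_radicand phi * bilin B g g).
    by apply/eqP; rewrite -addr_eq0 qfg.
  move: (quad_poly b) rE => Q rE; apply: Finj.
  rewrite [LHS]rmorphM [RHS]rmorphM /= XE YE qfg -[Frac Q]opprK -rE; ring.
- by apply: Finj; rewrite -bilin_map fE gE bilinZl bilinZr Bfg !mulr0 rmorph0.
have [j fgj] : exists j, (f 0 j != 0) || (g 0 j != 0).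
  exact: row_pair_neq0.
exists j; move: (quad_poly b) rE => Q rE.
have fjE : Frac (f' 0 j) = Frac q * f 0 j by have /rowP/(_ j) := fE; rewrite !mxE.
have gjE : Frac (g' 0 j) = Frac q * g 0 j by have /rowP/(_ j) := gE; rewrite !mxE.
move: (f' 0 j) (g' 0 j) fjE gjE => x y xE yE.
rewrite -F0 rmorphD !rmorphM /= xE yE.
rewrite -[Frac Q]opprK -rE.
have c0 : Frac (b 0 0)%:MP != 0 by rewrite F0 mpolyC_eq0 diagonalization_neq0.
have qF0 : Frac q != 0 by rewrite F0.
move: (function_field_radicand phi) nsq => d nsq.
(* After clearing denominators by [q], the polynomial is b_1 q^2 times the norm of f_j + g_j
   sqrt(d). *)
have := mulf_neq0 (mulf_neq0 c0 (expf_neq0 2 qF0)) (sqrt_norm_neq0 nsq fgj).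
apply: contra => /eqP e; apply/eqP; rewrite -[RHS]e; ring.
Qed.

End FunctionFieldIsotropy.

(** * A generic point reached by the parametrization *)

Lemma quadric_point_id (F : fieldType) (n : nat) (A : 'M[F]_n) (w z : 'rV[F]_n) :
  bilin A z z = 0 -> bilin A w z *+ 2 != 0 ->
  quadric_point A (- (bilin A w z *+ 2)^-1) w z = z.
Proof.
move=> zz wz; rewrite /quadric_point zz scale0r add0r scalerA mulrNN.
by rewrite mulVf // scale1r.
Qed.

Section GenericZero.
Variables (F : fieldType) (n : nat) (b : 'rV[F]_n.+2).
Hypotheses (two0 : 2%:R != 0 :> F) (b_neq0 : forall i, b 0 i != 0).

Lemma generic_zero : exists (E : fieldType)
    (h : {rmorphism {mpoly F[n.+1]} -> E}) (s : E),
  injective h /\ h (b 0 0)%:MP * s ^+ 2 = - h (quad_poly b).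
Proof.
pose Frac := @FracField.tofrac {mpoly F[n.+1]}.
pose d := - (Frac (quad_poly b) / Frac (b 0 0)%:MP).
have [s sd _] := adjoin_sqrtP d.
exists (adjoin_sqrt d), (ext_incl (adjoin_sqrt d) \o Frac), s; split.
  by move=> x y /= /fmorph_inj/eqP; rewrite tofrac_eq => /eqP.
rewrite sd /= -rmorphM -rmorphN; congr (ext_incl _ _).
have c0 : Frac (b 0 0)%:MP != 0 by rewrite tofrac_eq0 mpolyC_eq0.
by rewrite mulrN mulrC divfK.
Qed.

(** The parametrization from [w] reaches [z] only if B(w,z) is nonzero, which is arranged by the
    sign of the first coordinate of [z]. *)
Lemma generic_quadric_point (w : 'rV[F]_n.+2) :
  w != 0 -> bilin (diag_mx b) w w = 0 ->
  exists (E : fieldType) (h : {rmorphism {mpoly F[n.+1]} -> E}) (z : 'rV[E]_n.+2),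
  [/\ injective h, forall k, z 0 (lift ord0 k) = h 'X_k,
      bilin (map_mx (h \o @mpolyC _ F) (diag_mx b)) z z = 0 &
      bilin (map_mx (h \o @mpolyC _ F) (diag_mx b))
        (map_mx (h \o @mpolyC _ F) w) z != 0].
Proof.
move=> w0 ww; have [E [h [s [hI hs]]]] := generic_zero.
pose i : {rmorphism F -> E} := h \o @mpolyC n.+1 F.
pose z c : 'rV[E]_n.+2 := \row_k oapp (fun l => h 'X_l) c (unlift ord0 k).
have z0 c : z c 0 0 = c by rewrite mxE unlift_none.
have zS c k : z c 0 (lift ord0 k) = h 'X_k by rewrite mxE liftK.
have zz c : c ^+ 2 = s ^+ 2 -> bilin (map_mx i (diag_mx b)) (z c) (z c) = 0.
  move=> cs; rewrite eval_quad_poly z0 cs.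
  by rewrite (@eval_at_rmorph _ _ _ i (z c) h) ?hs ?addNr.
have : exists2 c, c ^+ 2 = s ^+ 2 &
    bilin (map_mx i (diag_mx b)) (map_mx i w) (z c) != 0.
  (* B(w,z) is b_1 w_1 c + l. If it vanished for both c = s and c = -s, then 2 l = 0. But l = 0
     leaves only w_1, and the isotropy of [w] kills that too. *)
  pose l : {mpoly F[n.+1]} :=
    \sum_k (b 0 (lift ord0 k) * w 0 (lift ord0 k))%:MP * 'X_k.
  have BE c : bilin (map_mx i (diag_mx b)) (map_mx i w) (z c) =
      i (b 0 0 * w 0 0) * c + h l.
    rewrite map_diag_mx bilin_diag big_ord_recl z0 !mxE -rmorphM.
    congr (_ + _); rewrite rmorph_sum; apply: eq_bigr => k _.
    by rewrite zS !mxE rmorphM /= mpolyCM rmorphM.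
  have l0 : l != 0.
    apply: contra w0 => /eqP l0.
    have wS k : w 0 (lift ord0 k) = 0.
      have := congr1 (mcoeff U_(k)%MM) l0; rewrite mcoeff0 raddf_sum /=.
      rewrite (bigD1 k) //= big1 => [|j jk].
        rewrite addr0 mcoeffCM mcoeffXU eqxx mulr1 => /eqP.
        by rewrite mulf_eq0 (negPf (b_neq0 _)) => /eqP.
      by rewrite mcoeffCM mcoeffXU (negPf jk) mulr0.
    apply/eqP/rowP => k; rewrite mxE; case: (unliftP ord0 k) => [j|] -> //.
    move: ww; rewrite bilin_diag big_ord_recl big1 => [|j _]; last first.
      by rewrite wS mulr0.
    by rewrite addr0 => /eqP; rewrite !mulf_eq0 (negPf (b_neq0 _)) orbb => /eqP.
  have [e|] := eqVneq (bilin (map_mx i (diag_mx b)) (map_mx i w) (z s)) 0;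
    last by exists s.
  exists (- s); first by rewrite sqrrN.
  rewrite BE mulrN; apply/negP => /eqP e'.
  have : h l *+ 2 = 0 by rewrite -[RHS]addr0 -{1}e -e' BE; ring.
  move/eqP; rewrite -mulr_natr mulf_eq0 -(rmorph0 h) (inj_eq hI) (negPf l0) /=.
  by rewrite rmorph0 -(rmorph_nat i) fmorph_eq0 (negPf two0).
by case=> c cs Bc; exists E, h, (z c); split=> //; apply: zz.
Qed.
End GenericZero.

(** * Transfer of isotropy from one form to the other *)

Section Transfer.
Variables (K : fieldType) (n m : nat).
Variables (phi : qform K n.+2) (psi : qform K m) (F : field_ext K).
Hypothesis ch2 : 2%N \notin [pchar K].
Local Notation b := (diagonalization phi).
Local Notation iF := (ext_incl F).

Lemma function_field_transfer : anisotropic psi ->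
  isotropic (base_change (function_field phi) psi) ->
  isotropic (base_change F phi) -> isotropic (base_change F psi).
Proof.
move=> apsi ipsi /(isotropic_diag _ _ ch2)[w [w0 ww]].
have [f [g [ffgg fg [j fgj]]]] := function_field_zero ch2 apsi ipsi.
have [//|/anisotropicP aF] := classic (isotropic (base_change F psi)).
pose bF := map_mx iF b.
have bF0 i : bF 0 i != 0 by rewrite mxE fmorph_eq0 diagonalization_neq0.
have two0 := pchar2_neq0 F ch2.
rewrite map_diag_mx -/bF in ww.
have [E [h [z [hI zS zz Bwz]]]] := generic_quadric_point two0 bF0 w0 ww.
pose C : {rmorphism F -> {mpoly F[n.+3]}} := @mpolyC n.+3 F.
pose hC : {rmorphism F -> E} := h \o @mpolyC n.+1 F.
pose D := map_mx C (diag_mx bF).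
(* Among the n+3 variables, the one of index 0 is the scale S and the others are the coordinates of
   [Y]. *)
pose Y : 'rV[{mpoly F[n.+3]}]_n.+2 := \row_k 'X_(lift ord0 k).
pose Z := quadric_point D 'X_ord0 (map_mx C w) Y.
pose i1 : {rmorphism K -> {mpoly F[n.+3]}} := C \o iF.
have DE : D = map_mx i1 (diag_mx b) by rewrite /D /bF -map_diag_mx -map_mx_comp.
have symD : D^T = D by rewrite DE map_diag_mx tr_diag_mx.
have CwCw : bilin D (map_mx C w) (map_mx C w) = 0 by rewrite bilin_map ww rmorph0.
have ZZ : bilin (map_mx i1 (diag_mx b)) Z Z = 0.
  by case: _ / DE; apply: (quadric_point_isotropic symD _ _ CwCw).
have b00 : b 0 0 != 0 by apply: diagonalization_neq0.
pose H := eval_row i1 f g Z.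
have HH : bilin (map_mx i1 (gram psi)) H H = 0.
  exact: eval_row_isotropic (gram_sym psi) b00 ZZ ffgg fg.
(* It suffices that [H] is nonzero after the specialization [e], which sends [Y] to the generic
   point [z] and S to the scale that makes [Z] equal to [z]. *)
have H0 : H != 0.
  pose B := bilin (map_mx hC (diag_mx bF)) (map_mx hC w) z.
  have B2 : B *+ 2 != 0.
    rewrite -mulr_natr; apply: mulf_neq0; first exact: Bwz.
    by rewrite -(rmorph_nat hC) fmorph_eq0.
  pose s0 : E := - (B *+ 2)^-1.
  pose e : {rmorphism {mpoly F[n.+3]} -> E} :=
    mmap hC (fun k => oapp (fun l => z 0 l) s0 (unlift ord0 k)).
  have eC x : e (C x) = hC x by rewrite /e /= mmapC.
  have eX k : e 'X_k = oapp (fun l => z 0 l) s0 (unlift ord0 k).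
    by rewrite /e /= mmapX mmap1U.
  have eZ : map_mx e Z = z.
    rewrite map_quadric_point eX unlift_none /= -!map_mx_comp.
    have -> : map_mx e Y = z by apply/rowP => k; rewrite !mxE eX liftK.
    have eCE p q (M : 'M_(p, q)) : map_mx (e \o C) M = map_mx hC M.
      by apply/matrixP => ? ?; rewrite !mxE; apply: eC.
    by rewrite !eCE; apply: quadric_point_id.
  apply: (@neq0_map_mx _ _ e); rewrite map_eval_row eZ.
  apply/rV0Pn; exists j.
  pose hK : {rmorphism {mpoly K[n.+1]} -> E} := h \o map_mpoly iF.
  have hKE : eval_at (e \o i1) z =1 hK.
    apply: eval_at_rmorph => [c|k]; rewrite /hK /=.
      by rewrite map_mpolyC; apply/esym/eC.
    by rewrite map_mpolyX zS.
  have hK0 p : hK p = 0 -> p = 0.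
    rewrite -(rmorph0 h) => /hI p0; apply/mpolyP => k; rewrite mcoeff0.
    apply/eqP; rewrite -(fmorph_eq0 iF) -mcoeff_map_mpoly.
    by rewrite [map_mpoly _ _]p0 mcoeff0.
  have qz : hK (quad_poly b) = - (hK (b 0 0)%:MP * z 0 0 ^+ 2).
    apply/eqP; rewrite -addr_eq0 addrC -hKE -hKE.
    have := zz; rewrite /bF -map_diag_mx -map_mx_comp.
    have -> : map_mx (h \o @mpolyC n.+1 F \o iF) (diag_mx b) = map_mx (e \o i1) (diag_mx b).
      by apply/matrixP => ? ?; rewrite !mxE; apply/esym/eC.
    by rewrite eval_quad_poly /eval_at mmapC => ->.
  rewrite !mxE !hKE mul1r; move: fgj; apply: contra => /eqP e0.
  apply/eqP; apply: hK0; move: (quad_poly b) qz => Q qz.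
  move: (f 0 j) (g 0 j) e0 => x y e0.
  rewrite rmorphD !rmorphM qz.
  (* On the quadric, b_1 times the norm factors as b_1 (x - z_0 y)(x + z_0 y), so a zero of the last
     factor would contradict [fgj]. *)
  rewrite (_ : _ + _ = hK (b 0 0)%:MP * (hK x - z 0 0 * hK y) * (hK x + z 0 0 * hK y)).
    by rewrite e0 mulr0.
  ring.
have := mlead_anisotropic aF H0; rewrite -map_mx_comp /= => -[/eqP[]].
exact: HH.
Qed.
End Transfer.

(** * From isotropy to products of two values *)

Lemma affine_root (F : fieldType) (a c s u v : F) : a != 0 -> u != 0 ->
  (s - c) / a * u + v = 0 -> c - v * a / u = s.
Proof.
move=> a0 u0 /eqP; rewrite addrC addr_eq0 => /eqP->; field.
by rewrite a0 u0.
Qed.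

(** This is the quadratic formula for A(t u + v, t u + v) = 0 in [t]; [s] is a root of its quarter
    discriminant. *)
Lemma bilin_root (F : fieldType) (n : nat) (A : 'M[F]_n) (u v : 'rV[F]_n) s :
  A^T = A -> bilin A u u != 0 ->
  s ^+ 2 = bilin A u v ^+ 2 - bilin A u u * bilin A v v ->
  let z := ((s - bilin A u v) / bilin A u u) *: u + 1 *: v in bilin A z z = 0.
Proof.
move=> symA a0 sE z; rewrite (bilin_comb symA) {z}; move: a0 sE.
move: (bilin A u u) (bilin A u v) (bilin A v v) => a c b a0 sE.
transitivity ((s ^+ 2 - (c ^+ 2 - a * b)) / a); last by rewrite sE subrr mul0r.
by field.
Qed.

Lemma isotropic_map (K : fieldType) (F F' : field_ext K) (h : {rmorphism F -> F'})
    (n : nat) (phi : qform K n) :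
  h \o ext_incl F =1 ext_incl F' ->
  isotropic (base_change F phi) -> isotropic (base_change F' phi).
Proof.
move=> hE [v [v0 qv]]; exists (map_mx h v).
split; first by rewrite map_mx_eq0.
rewrite /qeval -/(bilin _ _ _) /=.
have -> : map_mx (ext_incl F') (gram phi) = map_mx h (map_mx (ext_incl F) (gram phi)).
  by apply/matrixP => i j; rewrite !mxE -hE.
by rewrite bilin_map [bilin _ _ _]qv rmorph0.
Qed.

(** x = (y x) y^-1, and y^-1 = (y^-1)^2 y is again a value of [psi]. *)
Lemma DDset_quotient (K : fieldType) (F : field_ext K) (n : nat) (psi : qform K n)
    (x y : F) : x != 0 -> Dset psi y -> Dset psi (y * x) -> DDset psi x.
Proof.
move=> x0 [y0 [v qv]] Dyx; exists (y * x), y^-1; split=> //; last first.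
  by rewrite mulrAC mulfV // mul1r.
split; first by rewrite invr_eq0.
exists (y^-1 *: v); rewrite /qeval -/(bilin _ _ _) bilinZl bilinZr.
by rewrite [bilin _ _ _]qv mulVf // mulr1.
Qed.

Lemma isotropic_DDset (K : fieldType) (F : field_ext K) (n : nat) (psi : qform K n)
    (x : F) : 2%N \notin [pchar K] -> x != 0 ->
  isotropic (base_change F psi) -> DDset psi x.
Proof.
move=> ch2 x0 ipsi; have rep y := @isotropic_universal _ _ _ y (pchar2_neq0 F ch2) ipsi.
by exists x, 1; rewrite mulr1 /Dset oner_neq0; split.
Qed.

Lemma DDset_transfer (K : fieldType) (m n : nat)
    (phi : qform K m.+2) (psi : qform K n.+2) :
  2%N \notin [pchar K] -> anisotropic psi ->
  isotropic (base_change (function_field phi) psi) ->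
  forall (F : field_ext K) (x : F), DDset phi x -> DDset psi x.
Proof.
move=> ch2 apsi ipsi F x [a [b [[a0 [u qu]] [b0 [v qv]] xE]]].
have two0 := pchar2_neq0 F ch2.
have x0 : x != 0 by rewrite xE mulf_neq0.
have [iF|/anisotropicP aF] := classic (isotropic (base_change F psi)).
  exact: isotropic_DDset.
set B := gram (base_change F psi) in aF.
have symB : B^T = B by apply: gram_sym.
pose A := gram (base_change F phi).
have symA : A^T = A by apply: gram_sym.
have uu : bilin A u u = a by [].
have vv : bilin A v v = b by [].
pose c := bilin A u v; pose d := c ^+ 2 - a * b.
have DB (w : 'rV[F]_n.+2) : w != 0 -> Dset psi (bilin B w w).
  by move=> w0; split; [apply: contraNneq w0 => /aF/eqP | exists w].
have transfer (F' : field_ext K) := @function_field_transfer _ _ _ phi psi F' ch2 apsi ipsi.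
have [[s sd]|nsq] := classic (exists s, s ^+ 2 = d).
  have root : s ^+ 2 = c ^+ 2 - bilin A u u * bilin A v v by rewrite uu vv.
  have := bilin_root symA _ root; rewrite uu -/c => /(_ a0) /=.
  set al := (s - c) / a => zz.
  (* A nonzero vector here would make [psi] isotropic over [F]. Otherwise [u] and [v] are
     proportional and [x] is a square, so it is the quotient of psi(r w) by psi(w) with r = [al * a]
     and any nonzero [w]. *)
  have [z0|z0] := eqVneq (al *: u + 1 *: v) 0; last first.
    have [] : isotropic (base_change F psi) by apply: transfer; exists (al *: u + 1 *: v).
    by move=> w [w0 /aF w0']; rewrite w0' eqxx in w0.
  have vE : v = - al *: u.
    by apply/eqP; rewrite scaleNr -addr_eq0 addrC -[v]scale1r z0.
  have xsq : x = (al * a) ^+ 2.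
    by rewrite xE -vv vE bilinZl bilinZr uu; ring.
  pose w : 'rV[F]_n.+2 := delta_mx 0 0.
  have w0 : w != 0 by apply/rV0Pn; exists 0; rewrite mxE !eqxx oner_neq0.
  have ala0 : al * a != 0 by apply: contraNneq x0 => e; rewrite xsq e expr0n.
  apply: (DDset_quotient x0 (DB w w0)).
  have -> : bilin B w w * x = bilin B ((al * a) *: w) ((al * a) *: w).
    by rewrite bilinZl bilinZr xsq; ring.
  by apply: DB; rewrite scaler_eq0 negb_or ala0.
have [s sd _] := adjoin_sqrtP d.
pose E := adjoin_sqrt d; pose i := ext_incl E.
pose F' : field_ext K := Defs.FieldExt (i \o ext_incl F).
pose A' := map_mx i A.
have symA' : A'^T = A' by rewrite matrix.map_trmx symA.
have root : s ^+ 2 = bilin A' (map_mx i u) (map_mx i v) ^+ 2 -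
    bilin A' (map_mx i u) (map_mx i u) * bilin A' (map_mx i v) (map_mx i v).
  by rewrite !bilin_map uu vv sd rmorphB rmorphXn rmorphM.
have ia0 : bilin A' (map_mx i u) (map_mx i u) != 0 by rewrite bilin_map uu fmorph_eq0.
have := bilin_root symA' ia0 root; rewrite !bilin_map uu -/c /=.
set z := _ *: _ + _ => zz.
have z0 : z != 0.
  apply/negP => /eqP z0.
  have /rV0Pn[j uj] : u != 0.
    by apply: contraNneq a0 => u0; rewrite -uu u0 -(scale0r 0) bilinZl mul0r.
  (* If [z] vanished, its coordinate [j], where [u] is nonzero, could be solved for [s] within
     [F]. *)
  case: nsq; exists (c - v 0 j * a / u 0 j); apply: (fmorph_inj i).
  rewrite rmorphXn -sd; congr (_ ^+ 2).
  have := congr1 (fun M : 'rV__ => M 0 j) z0; rewrite !mxE mul1r.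
  rewrite rmorphB fmorph_div rmorphM; apply: affine_root; rewrite fmorph_eq0.
    exact: a0.
  exact: uj.
have [t [t0 qt]] : isotropic (base_change F' psi).
  apply: transfer; exists z; split=> //.
  by rewrite /qeval -/(bilin _ _ _) /= map_mx_comp.
have qt' : bilin (map_mx i B) t t = 0 by rewrite -map_mx_comp.
have [f [g [fg0 qfg Bfg]]] := isotropic_adjoin_nonsquare symB two0 nsq t0 qt'.
have g0 : g != 0.
  apply: contraTneq fg0 => g0; move: qfg.
  rewrite g0 -{1 2}(scale0r 0) bilinZl mul0r mulr0 addr0 => /aF ->.
  by rewrite eqxx.
apply: (DDset_quotient x0 (DB g g0)).
(* Since psi(f) = - d psi(g) and f, g are orthogonal, psi(c g + f) = (c^2 - d) psi(g), and c^2 - d =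
   a b = x. *)
have yx : bilin B g g * x = bilin B (c *: g + 1 *: f) (c *: g + 1 *: f).
  have -> : x = c ^+ 2 - d by rewrite xE /d; ring.
  rewrite (bilin_comb symB) [bilin B g f](bilinC symB) Bfg.
  have -> : bilin B f f = - (d * bilin B g g) by apply/eqP; rewrite -addr_eq0 qfg.
  ring.
have yx0 : bilin B g g * x != 0 by rewrite mulf_neq0 //; case: (DB g g0).
by split; last by rewrite yx; exists (c *: g + 1 *: f).
Qed.

(** * Parity of degrees and the way back to isotropy *)

(** Leading monomials of products add up, so parity of degree is multiplicative. This subgroup
    serves to separate values of an anisotropic form from a variable. *)
Lemma even_degree_subgroup (F : fieldType) (k : nat) :
  mul_subgroup (fun y : {fraction {mpoly F[k]}} => y != 0 /\
    exists p q : {mpoly F[k]}, [/\ p != 0, q != 0,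
      y * FracField.tofrac q = FracField.tofrac p &
      ~~ odd (mdeg (mlead p) + mdeg (mlead q))]).
Proof.
split.
- by move=> y [].
- split; first exact: oner_neq0.
  by exists 1, 1; rewrite !oner_neq0 mul1r mlead1 mdeg0.
- move=> x y [x0 [p [q [p0 q0 xE xe]]]] [y0 [p' [q' [p0' q0' yE ye]]]].
  split; first exact: mulf_neq0 x0 y0.
  exists (p * p'), (q * q'); split; rewrite ?mulf_neq0 //.
    by rewrite !rmorphM /= -xE -yE; ring.
  move: xe ye; rewrite !mleadM // !mdegD !oddD.
  by do 4!case: odd.
- move=> x [x0 [p [q [p0 q0 xE xe]]]].
  split; first by rewrite invr_eq0.
  by exists q, p; split; rewrite // -?xE 1?addnC // mulrA mulVf // mul1r.
Qed.

(** A common denominator [q] gives y q^2 = A(H,H) with [H] polynomial, and both q^2 and A(H,H) have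
    leading monomials of the form m + m. *)
Lemma Dset_even_degree (K : fieldType) (E : field_ext K) (n k : nat)
    (phi : qform K n) (i : {rmorphism K -> {fraction {mpoly E[k]}}}) :
  anisotropic (base_change E phi) ->
  i =1 @FracField.tofrac {mpoly E[k]} \o @mpolyC k E \o ext_incl E ->
  forall y, Dset (F := Defs.FieldExt i) phi y ->
  exists p q : {mpoly E[k]}, [/\ p != 0, q != 0,
      y * FracField.tofrac q = FracField.tofrac p &
      ~~ odd (mdeg (mlead p) + mdeg (mlead q))].
Proof.
move=> /anisotropicP aE iE y [y0 [v]]; rewrite /qeval -/(bilin _ _ _) /=.
have -> : map_mx i (gram phi) = map_mx (@FracField.tofrac {mpoly E[k]})
    (map_mx (@mpolyC k E) (map_mx (ext_incl E) (gram phi))).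
  by apply/matrixP => r s; rewrite !mxE iE.
move=> qv; have [q [H [q0 HE]]] := common_denominator v.
have qF0 : FracField.tofrac q != 0 by rewrite tofrac_eq0.
set A := map_mx (@mpolyC k E) _ in qv.
have yE : y * FracField.tofrac (q ^+ 2) = FracField.tofrac (bilin A H H).
  by rewrite -bilin_map -HE bilinZl bilinZr qv rmorphXn /=; ring.
have H0 : H != 0.
  apply/negP => /eqP e; move/eqP: HE; rewrite e map_mx0 scaler_eq0 (negPf qF0).
  move/eqP => v0; case/eqP: y0.
  by rewrite -qv v0 -(scale0r 0) bilinZl mul0r.
have [P0 [m mE]] := mlead_anisotropic aE H0.
exists (bilin A H H), (q ^+ 2); split=> //; first by rewrite expf_neq0.
by rewrite mE expr2 mleadM // !mdegD !oddD !addbb.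
Qed.

Lemma Ngroup_isotropic (K : fieldType) (m n : nat)
    (phi : qform K m) (psi : qform K n.+2) :
  2%N \notin [pchar K] ->
  (forall (F : field_ext K) (x : F), Ngroup psi x -> Ngroup phi x) ->
  isotropic (base_change (function_field psi) phi).
Proof.
move=> ch2 Nsub; have [//|aphi] := classic (isotropic (base_change (function_field psi) phi)).
have := function_field_isotropic psi ch2.
move: (function_field psi) aphi => E aphi ipsi.
pose Frac := @FracField.tofrac {mpoly E[1]}.
pose h : {rmorphism E -> {fraction {mpoly E[1]}}} := Frac \o @mpolyC 1 E.
pose i : {rmorphism K -> {fraction {mpoly E[1]}}} := h \o ext_incl E.
pose F : field_ext K := Defs.FieldExt i.
have iF : isotropic (base_change F psi) by apply: (@isotropic_map _ E F h).
pose t : F := Frac 'X_0.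
have X0 : 'X_0 != 0 :> {mpoly E[1]} by rewrite -msupp_eq0 msuppX.
have t0 : t != 0 by rewrite tofrac_eq0.
(* Membership of [t] in the group generated by products of values of [phi] is tested on the
   even-degree subgroup. *)
have /Nsub/(_ _ (even_degree_subgroup E 1)) : Ngroup psi t.
  by move=> G _; apply; apply: (@isotropic_DDset K F _ psi t ch2 t0 iF).
case.
  move=> y [a [b [Da Db ->]]].
  have [_ _ GM _] := even_degree_subgroup E 1.
  have iE : i =1 Frac \o @mpolyC 1 E \o ext_incl E by [].
  have G c (Dc : Dset (F := F) phi c) := conj (proj1 Dc) (Dset_even_degree aphi iE Dc).
  exact: GM (G a Da) (G b Db).
(* Here p = X q, so the degrees of [p] and [q] differ by one and their sum is odd. *)
move=> _ [p [q [p0 q0 tE]]].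
have /eqP : Frac ('X_0 * q) = Frac p by rewrite /Frac tofracM.
rewrite /Frac tofrac_eq => /eqP <-; rewrite mleadM // mleadXm mdegD mdeg1.
by rewrite -addnA addnn oddS odd_double.
Qed.

(** * The groups T and N, and the equivalences *)

(** Once 1 is a value, each value y = y 1 is itself a product of two values. *)
Lemma Tgroup_Ngroup (K : fieldType) (n : nat) (phi : qform K n) (F : field_ext K)
    (x : F) : represents phi 1 -> Tgroup phi x <-> Ngroup phi x.
Proof.
move=> [v qv]; have D1 : Dset phi (1 : F).
  split; first exact: oner_neq0.
  exists (map_mx (ext_incl F) v); rewrite /qeval -/(bilin _ _ _) bilin_map.
  by rewrite [bilin _ _ _]qv rmorph1.
split=> Gx G Gg GS; apply: Gx => // y.
  by move=> Dy; apply: GS; exists y, 1; rewrite mulr1.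
by move=> [a [b [Da Db ->]]]; apply: mul_subgroupM => //; apply: GS.
Qed.

Lemma Ngroup_DDset (K : fieldType) (m n : nat) (phi : qform K m) (psi : qform K n)
    (F : field_ext K) :
  (forall x : F, DDset psi x <-> DDset phi x) ->
  forall x : F, Ngroup psi x <-> Ngroup phi x.
Proof.
by move=> DE x; split=> Nx G Gg GS; apply: Nx => // y /DE; apply: GS.
Qed.

Theorem theorem3p18 (K : fieldType) (m n : nat)
    (phi : qform K m.+2) (psi : qform K n.+2) :
  2%N \notin [pchar K]%R ->
  anisotropic phi -> anisotropic psi ->
  [<-> stably_birational phi psi;
       forall (F : field_ext K) (x : F), DDset psi x <-> DDset phi x;
       forall (F : field_ext K) (x : F), Ngroup psi x <-> Ngroup phi x] /\
  (represents phi 1%R -> represents psi 1%R ->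
   [<-> stably_birational phi psi;
        forall (F : field_ext K) (x : F), DDset psi x <-> DDset phi x;
        forall (F : field_ext K) (x : F), Ngroup psi x <-> Ngroup phi x;
        forall (F : field_ext K) (x : F), Tgroup psi x <-> Tgroup phi x]).
Proof.
move=> ch2 aphi apsi.
have imp12 : stably_birational phi psi ->
    forall (F : field_ext K) (x : F), DDset psi x <-> DDset phi x.
  by move=> [iphi ipsi] F x; split; apply: DDset_transfer.
have imp31 : (forall (F : field_ext K) (x : F), Ngroup psi x <-> Ngroup phi x) ->
    stably_birational phi psi.
  by move=> N; split; apply: Ngroup_isotropic => // F x /N.
split=> [|phi1 psi1]; tfae=> //.
- by move=> DE F; apply: Ngroup_DDset.
- by move=> DE F; apply: Ngroup_DDset.
- by move=> N F x; rewrite !Tgroup_Ngroup.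
- by move=> T; apply: imp31 => F x; rewrite -!Tgroup_Ngroup.
Qed.
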